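(* Let $G$ be a graph with cover ideal $J(G)$. Then the following are equivalent: $\rho(J(G))=1$; $G$ is a bipartite graph; $\rho_a(J(G))=1$.
   Context: All graphs are finite and simple, with no isolated vertices. The cover ideal $J(G)$ of a graph $G$, over a field $\mathbb{K}$, is the ideal of $\mathbb{K}[x : x\in V(G)]$ generated by the monomials $\prod_{x\in\Gamma}x$, $\Gamma$ a vertex cover of $G$; equivalently $J(G)=\bigcap_{\{x,y\}\in E(G)}(x,y)$. For an ideal $I$ in a Noetherian ring $R$, $I^{(s)}=\bigcap_{P\in\mathrm{Ass}(I)}(I^sR_P\cap R)$ is the $s$-th symbolic power. The resurgence and asymptotic resurgence are $\rho(I)=\sup\{s/t : s,t\in\mathbb{N},\ I^{(s)}\not\subset I^t\}$ and $\rho_a(I)=\sup\{s/t : s,t\in\mathbb{N},\ I^{(sr)}\not\subset I^{tr}\text{ for all } r\gg0\}$, where $\mathbb{N}$ denotes the positive integers. *)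

(* Defs.v *)
From mathcomp Require Import all_boot all_order all_algebra.
From mathcomp Require Import mpoly.
From mathcomp Require Import boolp classical_sets filter reals ereal topology.

Set Implicit Arguments.
Unset Strict Implicit.
Unset Printing Implicit Defensive.

Import Order.TTheory GRing.Theory Num.Theory.

Local Open Scope classical_set_scope.
Local Open Scope ring_scope.

Section Ideals.
Variable R : comNzRingType.
Implicit Types (I P G : set R) (s t : nat).

(* Unlike [idealr_closed], this allows the unit ideal: it is needed as I^0,
   and so that [ideal_gen] is the generated ideal for every G. *)
Definition is_ideal I : Prop :=
  [/\ I 0, (forall a b, I a -> I b -> I (a + b))
    & forall r a, I a -> I (r * a)].

Definition ideal_gen G : set R := smallest is_ideal G.

Definition ideal_power I s : set R :=
  ideal_gen [set x | exists2 f : 'I_s -> R,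
    (forall i, I (f i)) & x = \prod_(i < s) f i].

Definition is_prime_ideal P : Prop :=
  [/\ is_ideal P, ~ P 1 & forall a b, P (a * b) -> P a \/ P b].

Definition colon I (x : R) : set R := [set r | I (r * x)].

(* Ass(I) is the set of associated primes of the module R/I: the prime ideals
   that are the annihilator of the class of some x in R/I. *)
Definition associated_prime I P : Prop :=
  is_prime_ideal P /\ exists x, P = colon I x.

(* Equality a/u = b/v in the localization R_P (for u, v outside P). *)
Definition loc_eq P (a u b v : R) : Prop :=
  exists2 w, ~ P w & w * (a * v - b * u) = 0.

(* I R_P \cap R, that is, the preimage of I R_P under R -> R_P, f |-> f/1;
   the elements of I R_P are the fractions a/u with a in I and u not in P. *)
Definition loc_contraction I P : set R :=
  [set f | exists a u, [/\ I a, ~ P u & loc_eq P f 1 a u]].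

Definition symbolic_power I s : set R :=
  \bigcap_(P in associated_prime I) loc_contraction (ideal_power I s) P.

(* The suprema are taken in the extended reals: they need not be finite for an
   arbitrary ideal, and the supremum of the empty set is -oo. *)
Definition resurgence (F : realType) I : \bar F :=
  ereal_sup [set z | exists s t : nat,
    [/\ (0 < s)%N, (0 < t)%N,
        ~ (symbolic_power I s `<=` ideal_power I t)
      & z = (s%:R / t%:R)%:E]].

Definition asymptotic_resurgence (F : realType) I : \bar F :=
  ereal_sup [set z | exists s t : nat,
    [/\ (0 < s)%N, (0 < t)%N,
        (\forall r \near \oo,
          ~ (symbolic_power I (s * r)%N `<=` ideal_power I (t * r)%N))
      & z = (s%:R / t%:R)%:E]].

End Ideals.

Section Graphs.
Variable V : finType.
Implicit Types (e : rel V) (C : {set V}).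

Definition simple_graph e : Prop := ssrbool.symmetric e /\ irreflexive e.

Definition no_isolated_vertex e : Prop := forall x, exists y, e x y.

Definition vertex_cover e C : Prop :=
  forall x y, e x y -> x \in C \/ y \in C.

Definition bipartite e : Prop :=
  exists A : {set V}, forall x y, e x y -> (x \in A) != (y \in A).

(* K[x : x \in V]; the variable attached to the vertex x is the one whose index
   is the rank of x in the enumeration of V. *)
Definition vertex_ring (K : fieldType) : comNzRingType := {mpoly K[#|V|]}.

Definition vertex_var (K : fieldType) (x : V) : vertex_ring K :=
  'X_(enum_rank x) : {mpoly K[#|V|]}.

Definition cover_ideal (K : fieldType) e : set (vertex_ring K) :=
  ideal_gen [set m | exists2 C, vertex_cover e C &
                       m = \prod_(x in C) vertex_var K x].

End Graphs.

Arguments vertex_var {V} K x.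
Arguments cover_ideal {V} K e.

(* Main.v *)
Require Import Defs.
From mathcomp Require Import all_boot all_order all_algebra.
From mathcomp Require Import mpoly zify.
From mathcomp Require Import boolp classical_sets reals ereal.

Set Implicit Arguments.
Unset Strict Implicit.
Unset Printing Implicit Defensive.

Import Order.TTheory GRing.Theory Num.Theory.

Local Open Scope classical_set_scope.
Local Open Scope ring_scope.

(** Write J for the cover ideal and p_xy for the ideal (x, y) of an edge xy.
    Everything is read off the exponents of monomials. For an additive weight
    on monomials, the polynomials all of whose terms have weight at least k
    form an ideal, and weights add up in products ([weight_idealM]); dividing by
    a polynomial with a term of weight 0 keeps one inside these ideals
    ([weight_ideal_division]). For the edge weight, the sum of the exponents of
    x and y, the ideal of weight 1 is p_xy.

    The ideals p_xy are associated primes of J ([edge_ideal_associated]), so an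
    element of the s-th symbolic power has every edge weight at least s in each
    of its terms ([symbolic_power_edge]). Conversely every associated prime of
    J lies in some p_xy ([associated_prime_sub_edge]), so that an element is in
    a symbolic power as soon as, for each edge, the variables outside that
    edge, taken as units, bring it into the ordinary power.

    If G is bipartite with parts A and B, a monomial whose edge weights are all
    at least s is divisible by a product of s vertex covers: for i < s, the i-th
    takes the z in A of exponent greater than i and the z in B of exponent at
    least s - i. Hence symbolic and ordinary powers coincide, the s-th symbolic
    power lies in the t-th power exactly when t <= s
    ([bipartite_symbolic_sub], [symbolic_not_sub]), and both suprema are those
    of the fractions s/t with s < t, which is 1.

    If G is not bipartite, it has a closed walk of odd length 2k - 1. Weigh a
    vertex by its number of visits. A cover meets each of the 2k - 1 edges of
    the walk and each visit is shared by two edges, so a cover has weight at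
    least k. The product of all variables has weight 2k - 1 < 2k, yet it lies
    in the symbolic square. Its powers separate symbolic from ordinary powers
    at the fixed ratio (2k + 2)/(2k + 1) > 1, at every scale
    ([nonbipartite_gap]), so both suprema exceed 1. *)

(** * Ideals, their powers and symbolic powers *)

Section IdealFacts.
Variable R : comNzRingType.
Implicit Types (I P G : set R) (k s : nat).

Lemma ideal_gen_is_ideal G : is_ideal (ideal_gen G).
Proof.
split=> [I [[]]//|a b Ga Gb I HI|r a Ga I HI].
  by case: (HI) => -[_ addI _] _; apply: addI; [exact: Ga | exact: Gb].
by case: (HI) => -[_ _ mulI] _; apply: mulI; exact: Ga.
Qed.

Lemma ideal_genM G r a : ideal_gen G a -> ideal_gen G (r * a).
Proof. by case: (ideal_gen_is_ideal G) => _ _; apply. Qed.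

Lemma ideal_sum I (J : Type) (r : seq J) (Q : pred J) (f : J -> R) :
  is_ideal I -> (forall j, Q j -> I (f j)) -> I (\sum_(j <- r | Q j) f j).
Proof. by case=> I0 addI _ If; apply: (big_ind I). Qed.

Lemma prod_in_ideal_power I s (f : 'I_s -> R) :
  (forall i, I (f i)) -> ideal_power I s (\prod_(i < s) f i).
Proof. by move=> If; apply: sub_gen_smallest; exists f. Qed.

Lemma expr_in_ideal_power I s (a : R) : I a -> ideal_power I s (a ^+ s).
Proof.
move=> Ia; have := @prod_in_ideal_power I s (fun=> a) (fun=> Ia).
by rewrite prodr_const card_ord.
Qed.

(** An element u outside P becomes invertible in R_P, so the fraction
    (f u) / u exhibits f in the contraction. *)
Lemma loc_contraction_unit I P (f u : R) :
  I (f * u) -> ~ P u -> ~ P 1 -> loc_contraction I P f.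
Proof.
move=> Ifu Pu P1; exists (f * u), u; split=> //; exists 1 => //.
by rewrite mulr1 subrr mulr0.
Qed.

Lemma ideal_power_sub_symbolic I s : ideal_power I s `<=` symbolic_power I s.
Proof.
move=> f If P [[_ P1 _] _]; apply: (@loc_contraction_unit _ _ _ 1) => //.
by rewrite mulr1.
Qed.

End IdealFacts.

(** * Monomial weights *)

Section Weights.
Variables (n : nat) (K : fieldType) (wt : 'X_{1..n} -> nat).
Hypothesis wtD : forall a b, wt (a + b)%MM = (wt a + wt b)%N.
Implicit Types p q f u : {mpoly K[n]}.

Definition weight_ideal k : set {mpoly K[n]} :=
  [set p | forall m, m \in msupp p -> (k <= wt m)%N].

Lemma weight_idealW j k p : (j <= k)%N -> weight_ideal k p -> weight_ideal j p.
Proof. by move=> jk kp m /kp; exact: leq_trans. Qed.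

Lemma weight_idealD k p q :
  weight_ideal k p -> weight_ideal k q -> weight_ideal k (p + q).
Proof.
by move=> kp kq m /msuppD_le; rewrite mem_cat => /orP[/kp|/kq].
Qed.

Lemma weight_idealN k p : weight_ideal k p -> weight_ideal k (- p).
Proof. by move=> kp m; rewrite (perm_mem (msuppN p)); exact: kp. Qed.

Lemma weight_idealM j k p q :
  weight_ideal j p -> weight_ideal k q -> weight_ideal (j + k) (p * q).
Proof.
move=> jp kq m /msuppM_le /allpairsP[[a b] /= [/jp ja /kq kb ->]].
by rewrite wtD leq_add.
Qed.

Lemma weight_ideal_is_ideal k : @is_ideal {mpoly K[n]} (weight_ideal k).
Proof.
split=> [m||r a ka]; first by rewrite msupp0.
  by move=> a b; exact: weight_idealD.
by rewrite -[k]add0n; apply: weight_idealM.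
Qed.

(** The lower bound used for ordinary powers: only the least weight of an
    element of I matters. *)
Lemma weight_ideal_power (I : set {mpoly K[n]}) c k :
  I `<=` weight_ideal c ->
  @ideal_power {mpoly K[n]} I k `<=` weight_ideal (k * c).
Proof.
move=> Ic; apply: smallest_sub; first exact: weight_ideal_is_ideal.
move=> _ [f If ->].
elim: k f If => [|k IHk] f If; first by rewrite mul0n.
rewrite big_ord_recl mulSn; apply: weight_idealM; first exact/Ic/If.
by apply: IHk => i; exact: If.
Qed.

Lemma weight_idealX k m : weight_ideal k 'X_[m] <-> (k <= wt m)%N.
Proof.
split=> [|km _ /[!msuppX]/[!inE]/eqP->//].
by apply; rewrite msuppX mem_head.
Qed.

Definition select_terms (Q : pred 'X_{1..n}) p : {mpoly K[n]} :=
  \sum_(m <- msupp p | Q m) p@_m *: 'X_[m].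

Lemma mcoeff_select_terms Q p m :
  (select_terms Q p)@_m = if Q m then p@_m else 0.
Proof.
rewrite raddf_sum /=.
under eq_bigr do rewrite mcoeffZ mcoeffX.
case: (boolP (m \in msupp p)) => [mp|mp].
  rewrite big_mkcond (bigD1_seq m) ?msupp_uniq //= eqxx mulr1 big1 ?addr0 //.
  by move=> a am; rewrite (negPf am) mulr0 if_same.
rewrite big_seq_cond big1 => [|a /andP[ap _]].
  by rewrite (memN_msupp_eq0 mp) if_same.
by case: eqP => [ma|_]; [rewrite -ma ap in mp | rewrite mulr0].
Qed.

Lemma msupp_select_terms Q p m :
  (m \in msupp (select_terms Q p)) = Q m && (m \in msupp p).
Proof.
by rewrite !mcoeff_msupp mcoeff_select_terms; case: (Q m); rewrite ?eqxx.
Qed.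

Lemma select_termsC Q p : p = select_terms Q p + select_terms (predC Q) p.
Proof.
apply/mpolyP => m; rewrite mcoeffD !mcoeff_select_terms /=.
by case: (Q m); rewrite ?addr0 ?add0r.
Qed.

(** Going from k to k + 1: the weight-k part of f times the weight-0 part of u
    has all its terms of weight k, and it differs from f u by terms of weight
    greater than k. If f u has no term of weight k, this product therefore
    vanishes, hence so does the weight-k part of f, since polynomials form a
    domain. *)
Lemma weight_ideal_division k f u :
  weight_ideal k (f * u) -> ~ weight_ideal 1 u -> weight_ideal k f.
Proof.
move=> kfu u_wt0; elim: k kfu => [//|k IHk] kfu.
have kf : weight_ideal k f by apply: IHk; apply: weight_idealW kfu.
pose fk := select_terms (fun m => wt m == k) f.
pose f' := select_terms (predC (fun m => wt m == k)) f.
pose u0 := select_terms (fun m => wt m == 0%N) u.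
pose u' := select_terms (predC (fun m => wt m == 0%N)) u.
have fE : f = fk + f' by exact: select_termsC.
have uE : u = u0 + u' by exact: select_termsC.
have f'_wt : weight_ideal k.+1 f'.
  by move=> m; rewrite msupp_select_terms /= => /andP[mk /kf]; lia.
have u'_wt : weight_ideal 1 u'.
  by move=> m; rewrite msupp_select_terms /= => /andP[]; lia.
have fk_wt : weight_ideal k fk.
  by move=> m; rewrite msupp_select_terms => /andP[/eqP->].
have u0_neq0 : u0 != 0.
  apply/eqP => u0_eq0; apply: u_wt0.
  by rewrite uE u0_eq0 add0r.
have lead_wt : weight_ideal k.+1 (fk * u0).
  have -> : fk * u0 = f * u - (fk * u' + f' * u).
    by rewrite {1}fE mulrDl opprD addrA addrAC addrK {1}uE mulrDr addrK.
  apply: weight_idealD => //; apply: weight_idealN; apply: weight_idealD.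
    by rewrite -addn1; apply: weight_idealM.
  by rewrite -[k.+1]addn0; apply: weight_idealM.
have lead0 : fk * u0 = 0.
  apply/eqP; rewrite -msupp_eq0; apply/negPn/negP => /eqP nz.
  case E : (msupp (fk * u0)) => [//|m ms].
  have mlead : m \in msupp (fk * u0) by rewrite E mem_head.
  have := lead_wt _ mlead.
  move/msuppM_le: mlead => /allpairsP[[a b] /=].
  rewrite !msupp_select_terms => -[/andP[/eqP ak _] /andP[/eqP b0 _] ->].
  by rewrite wtD ak b0 addn0 ltnn.
move/eqP: lead0; rewrite mulf_eq0 (negPf u0_neq0) orbF => /eqP fk0.
by rewrite fE fk0 add0r.
Qed.

End Weights.

(** * Cover ideals *)

Section CoverIdeals.
Variables (K : fieldType) (V : finType) (e : rel V).
Hypothesis e_simple : simple_graph e.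

Local Notation n := #|V|.
Local Notation S := {mpoly K[n]}.
Local Notation J := (cover_ideal K e).
Local Notation "m .@ x" := (m (enum_rank x)) (at level 2).

Definition cover_mnm (C : {set V}) : 'X_{1..n} :=
  [multinom (enum_val i \in C : nat) | i < n].

Lemma cover_mnmE C x : (cover_mnm C).@x = (x \in C).
Proof. by rewrite mnmE enum_rankK. Qed.

Lemma prod_vertex_var (C : {set V}) :
  \prod_(x in C) vertex_var K x = 'X_[cover_mnm C] :> S.
Proof.
rewrite mpolyXE_id (reindex (@enum_rank V)) /=; last first.
  exact/onW_bij/enum_rank_bij.
rewrite [LHS]big_mkcond; apply: eq_bigr => x _.
by rewrite cover_mnmE; case: (x \in C).
Qed.

Lemma monomials_in_ideal (I : set S) (f : S) :
  @is_ideal S I -> (forall m, m \in msupp f -> I 'X_[m]) -> I f.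
Proof.
move=> idI If; rewrite (mpolyE f) big_seq; apply: ideal_sum => // m /If Im.
by rewrite -mul_mpolyC; case: idI => _ _; exact.
Qed.

Lemma cover_monomial_in C : vertex_cover e C -> J 'X_[cover_mnm C].
Proof.
by move=> Ccov; apply: sub_gen_smallest; exists C; rewrite ?prod_vertex_var.
Qed.

Lemma monomial_in_cover_power s (C : 'I_s -> {set V}) (m : 'X_{1..n}) :
  (forall i, vertex_cover e (C i)) ->
  (forall x, (\sum_(i < s) (x \in C i) <= m.@x)%N) ->
  ideal_power J s 'X_[m].
Proof.
move=> Ccov Cm; pose c := (\sum_(i < s) cover_mnm (C i))%MM.
have cE x : c.@x = (\sum_(i < s) (x \in C i))%N.
  by rewrite mnm_sumE; apply: eq_bigr => i _; rewrite cover_mnmE.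
have cm : (c <= m)%MM by apply/mnm_lepP => i; rewrite -[i]enum_valK cE Cm.
rewrite -(submK cm) mpolyXD.
apply: ideal_genM.
have -> : 'X_[c] = \prod_(i < s) 'X_[cover_mnm (C i)] :> S.
  by rewrite /c; elim/big_rec2: _ => [|i p q _ <-]; rewrite ?mpolyX0 ?mpolyXD.
by apply: prod_in_ideal_power => i; exact: cover_monomial_in.
Qed.

Definition edge_wt (x y : V) (m : 'X_{1..n}) : nat := (m.@x + m.@y)%N.

Lemma edge_wtD x y a b :
  edge_wt x y (a + b)%MM = (edge_wt x y a + edge_wt x y b)%N.
Proof. by rewrite /edge_wt !mnmDE; lia. Qed.

Lemma cover_ideal_wt (wt : 'X_{1..n} -> nat) c :
  (forall a b, wt (a + b)%MM = (wt a + wt b)%N) ->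
  (forall C, vertex_cover e C -> (c <= wt (cover_mnm C))%N) ->
  J `<=` weight_ideal wt c.
Proof.
move=> wtD cwt; apply: smallest_sub; first exact: weight_ideal_is_ideal.
by move=> _ [C Ccov ->]; rewrite prod_vertex_var; apply/weight_idealX/cwt.
Qed.

Lemma cover_ideal_edge x y : e x y -> J `<=` weight_ideal (edge_wt x y) 1.
Proof.
move=> exy; apply: cover_ideal_wt; first exact: edge_wtD.
move=> C /(_ x y exy); rewrite /edge_wt !cover_mnmE.
by case=> ->; rewrite ?addn1.
Qed.

(** This is the intersection of the p_xy being contained in J: the vertices
    that occur in a term form a vertex cover, whose monomial divides the
    term. *)
Lemma cover_idealI (f : S) :
  (forall x y, e x y -> weight_ideal (edge_wt x y) 1 f) -> J f.
Proof.
move=> fe; apply: monomials_in_ideal => [|m mf].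
  exact: ideal_gen_is_ideal.
have mcov : vertex_cover e [set x | (0 < m.@x)%N].
  by move=> x y exy; have := fe _ _ exy _ mf; rewrite !inE /edge_wt; lia.
have cm : (cover_mnm [set x | (0 < m.@x)%N] <= m)%MM.
  apply/mnm_lepP => i; rewrite -[i]enum_valK cover_mnmE inE.
  by case: (m.@_).
rewrite -(submK cm) mpolyXD.
apply: ideal_genM.
exact: cover_monomial_in.
Qed.

Lemma cover_of_compl1 x : vertex_cover e (~: [set x]).
Proof.
move=> y z eyz; rewrite !inE; case: eqP => [yx|]; last by left.
by right; apply/eqP => zx; rewrite yx zx (proj2 e_simple) in eyz.
Qed.

(** p_xy is the annihilator modulo J of the product of the vertices other than
    x and y. That product meets every edge except xy itself, as there are
    neither loops nor multiple edges. It has edge weight 0 along xy, so no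
    further multiplier enters J. *)
Lemma edge_ideal_associated x y : e x y ->
  associated_prime J (weight_ideal (edge_wt x y) 1).
Proof.
move=> exy; have xy : x != y.
  by apply/eqP => xy; rewrite xy (proj2 e_simple) in exy.
split.
  split; first by apply: weight_ideal_is_ideal; exact: edge_wtD.
    by move=> /(_ 0%MM); rewrite msupp1 mem_head /edge_wt !mnm0E => /(_ isT).
  move=> a b ab; case: (EM (weight_ideal (edge_wt x y) 1 b)) => nb.
    by right.
  by left; apply: weight_ideal_division ab nb; exact: edge_wtD.
exists ('X_[cover_mnm (~: [set x; y])] : S).
apply/seteqP; split=> f /=.
  move=> fxy; apply: cover_idealI => a b eab ?.
  move=> /msuppM_le /allpairsP[[m c] /= [mf]]; rewrite msuppX inE => /eqP-> ->.
  have := fxy _ mf; rewrite edge_wtD /edge_wt !cover_mnmE !inE.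
  have ab : a != b by apply/eqP => ab; rewrite ab (proj2 e_simple) in eab.
  case: (boolP ((a == x) || (a == y))) => [|_]; last by lia.
  case: (boolP ((b == x) || (b == y))) => [|_]; last by lia.
  by case/orP=> /eqP bE; case/orP=> /eqP aE; move: ab;
    rewrite aE bE ?eqxx //= ?addn0 ?(addnC m.@y).
move=> Jfm; apply: (@weight_ideal_division _ _ _ (@edge_wtD x y) _ _
  'X_[cover_mnm (~: [set x; y])]).
  exact: (cover_ideal_edge exy Jfm).
by move/weight_idealX; rewrite /edge_wt !cover_mnmE !inE !eqxx orbT.
Qed.

(** If P is the annihilator of f modulo J, then f misses some p_xy, and r f in
    p_xy forces r in p_xy. In fact P is then equal to p_xy, but the inclusion is
    what makes the variables outside xy units of the localization at P. *)
Lemma associated_prime_sub_edge (P : set S) : @associated_prime S J P ->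
  exists x y, e x y /\ P `<=` weight_ideal (edge_wt x y) 1.
Proof.
move=> [[_ P1 _] [f PE]].
have Jf : ~ J f by move=> Jf; apply: P1; rewrite PE /colon /= mul1r.
have [x [y [exy fxy]]] :
    exists x y, e x y /\ ~ weight_ideal (edge_wt x y) 1 f.
  apply: contrapT => none; apply: Jf; apply: cover_idealI => x y exy.
  by apply: contrapT => nf; apply: none; exists x, y.
exists x, y; split=> // r; rewrite PE => Jrf.
apply: weight_ideal_division fxy; first exact: edge_wtD.
exact: (cover_ideal_edge exy Jrf).
Qed.

Lemma symbolic_power_edge s x y : e x y ->
  symbolic_power J s `<=` weight_ideal (edge_wt x y) s.
Proof.
move=> exy f /(_ _ (edge_ideal_associated exy)) [a [u [Ja uP [w wP]]]].
rewrite mulr1 => /eqP; rewrite (@mulf_eq0 S) => /orP[/eqP w0|].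
  by case: wP; rewrite w0; have [] := weight_ideal_is_ideal K (@edge_wtD x y) 1.
rewrite subr_eq0 => /eqP fu.
apply: weight_ideal_division uP; first exact: edge_wtD.
rewrite fu -[s]muln1.
by apply: (weight_ideal_power (@edge_wtD x y)) Ja; exact: cover_ideal_edge.
Qed.

(** Locally at xy, the product of all variables is, up to the unit formed by
    the variables other than x and y, the product of the two covers that omit
    only x and only y. *)
Lemma vertices_in_symbolic_square r :
  symbolic_power J (2 * r) ('X_[cover_mnm [set: V]%SET] ^+ r : S).
Proof.
move=> P Pass; have [x [y [exy Pxy]]] := associated_prime_sub_edge Pass.
have xy : x != y.
  by apply/eqP => xy; rewrite xy (proj2 e_simple) in exy.
apply: (@loc_contraction_unit _ _ _ _
  ('X_[cover_mnm (~: [set x; y])] ^+ r : S)).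
- rewrite !mpolyXn -mpolyXD mul2n -addnn.
  apply: (@monomial_in_cover_power _
    (fun i : 'I_(r + r) => ~: [set if (i < r)%N then x else y])) => [i|z].
    exact: cover_of_compl1.
  rewrite big_split_ord /=.
  under eq_bigr => i _ do rewrite ltn_ord.
  under [X in (_ + X <= _)%N]eq_bigr => i _ do rewrite ltnNge leq_addr /=.
  rewrite !sum_nat_const !card_ord mnmDE !mulmnE !cover_mnmE !inE.
  case: (eqVneq z x) => [->|_]; first by rewrite (negPf xy) /=; lia.
  by case: (z == y) => /=; lia.
- move/Pxy; rewrite mpolyXn => /weight_idealX.
  by rewrite /edge_wt !mulmnE !cover_mnmE !inE !eqxx orbT.
- by case: Pass => -[].
Qed.

(** The cover omitting only x has weight exactly 1 on an edge xy. *)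
Lemma expr_notin_cover_power s t x y : e x y -> (s < t)%N ->
  ~ ideal_power J t ('X_[cover_mnm (~: [set x])] ^+ s : S).
Proof.
move=> exy st Jt; have xy : x != y.
  by apply/eqP => xy; rewrite xy (proj2 e_simple) in exy.
have := weight_ideal_power (@edge_wtD x y) (cover_ideal_edge exy) Jt.
rewrite mpolyXn => /weight_idealX.
rewrite /edge_wt !mulmnE !cover_mnmE !inE eqxx (eq_sym y) xy /=; lia.
Qed.

Lemma symbolic_not_sub s t : (exists x y, e x y) -> (s < t)%N ->
  ~ (symbolic_power J s `<=` ideal_power J t).
Proof.
move=> [x [y exy]] st sub; apply: (expr_notin_cover_power exy st); apply: sub.
apply: ideal_power_sub_symbolic; apply: expr_in_ideal_power.
apply: cover_monomial_in; exact: cover_of_compl1.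
Qed.

(** * Bipartite graphs *)

Lemma sum_ltn_le t k : (\sum_(i < t) (i < k) <= k)%N.
Proof.
suff -> : (\sum_(i < t) (i < k) = minn t k)%N by rewrite geq_minr.
by elim: t => [|t IHt]; rewrite ?big_ord0 ?min0n // big_ord_recr /= IHt; lia.
Qed.

Lemma sum_leq_add_le t k : (\sum_(i < t) (t <= i + k) <= k)%N.
Proof.
rewrite (reindex_inj rev_ord_inj) /=; apply: leq_trans (sum_ltn_le t k).
by apply: leq_sum => i _; have := ltn_ord i; case: (ltnP i k); lia.
Qed.

(** On an edge with x in A and y outside A, the i-th set of the decomposition
    misses x only if the exponent of x is at most i; then that of y is at least
    t - i and the set contains y. A vertex of A lies in the sets with i below
    its exponent, the others in as many of the last sets as their exponent. *)
Lemma bipartite_symbolic_sub s t : bipartite e -> (t <= s)%N ->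
  symbolic_power J s `<=` ideal_power J t.
Proof.
move=> [A Abip] ts f Jsf.
apply: monomials_in_ideal => [|m mf]; first exact: ideal_gen_is_ideal.
have m_edge x y : e x y -> (t <= m.@x + m.@y)%N.
  by move=> exy; apply: leq_trans ts _; exact: (symbolic_power_edge exy Jsf mf).
pose C (i : 'I_t) : {set V} :=
  [set z | if z \in A then (i < m.@z)%N else (t <= i + m.@z)%N]%SET.
apply: (@monomial_in_cover_power _ C) => [i x y exy|z].
  have := Abip x y exy; have := m_edge _ _ exy; rewrite !inE.
  by case: (x \in A); case: (y \in A) => // xy _;
    apply/orP; rewrite -implyNb; apply/implyP; lia.
under eq_bigr => i _ do rewrite inE.
by case: (z \in A); [exact: sum_ltn_le | exact: sum_leq_add_le].
Qed.

(** * Non-bipartite graphs *)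

(** The bipartite double cover: its walks are the walks of G together with the
    parity of the number of steps. *)
Definition double_cover : rel (V * bool) :=
  fun u v => e u.1 v.1 && (u.2 != v.2).

Lemma double_cover_path u p : path double_cover u p ->
  path e u.1 (map fst p) /\ (last u p).2 = u.2 (+) odd (size p).
Proof.
elim: p u => [|v p IHp] u /=; first by rewrite addbF.
case/andP=> /andP[euv uv] /IHp[ep ->]; rewrite euv; split=> //.
by case: (u.2) (v.2) uv => [] [] //=; case: (odd _).
Qed.

Lemma double_cover_lift x y a : connect e x y ->
  exists b, connect double_cover (x, a) (y, b).
Proof.
move=> /connectP[p + ->]; elim: p x a => [|z p IHp] x a /=.
  by exists a.
move=> /andP[exz /(IHp _ (~~ a))[b zb]]; exists b.
apply: connect_trans zb; apply: connect1.
by rewrite /double_cover /= exz; case: a.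
Qed.

(** In each component, call a vertex even if it reaches the root of the
    component in an even number of steps. If some edge xy joined vertices of
    equal parity, walking from x to the root, back to y and along the edge to x
    would be an odd closed walk. So without odd closed walks the even vertices
    form one part of a bipartition. *)
Lemma odd_closed_walk : ~ bipartite e ->
  exists x p, [/\ path e x p, last x p = x & odd (size p)].
Proof.
move=> nbip; have [e_sym _] := e_simple.
have [x /connectP[p dp px]] :
    exists x, connect double_cover (x, false) (x, true).
  apply: contrapT => none; apply: nbip.
  have d_sym : connect_sym double_cover.
    by apply: sym_connect_sym => u v; rewrite /double_cover e_sym eq_sym.
  have e_csym : connect_sym e by apply: sym_connect_sym.
  pose r := fingraph.root e.
  exists [set x | connect double_cover (x, false) (r x, false)]%SET => x y exy.
  have rxy : r y = r x by apply/esym/(fingraph.rootP e_csym)/connect1.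
  rewrite !inE rxy; apply/negP => /eqP same; apply: none; exists x.
  have [b [xb yb]] : exists b, connect double_cover (x, false) (r x, b) /\
      connect double_cover (y, false) (r x, b).
    case xA: (connect double_cover (x, false) _) same => [] /esym yA.
      by exists false.
    have [[] xb] := double_cover_lift false (connect_root e x); last first.
      by rewrite xb in xA.
    have [[] yb] := double_cover_lift false (connect_root e y); last first.
      by rewrite -rxy yb in yA.
    by exists true; rewrite -{2}rxy.
  apply: connect_trans xb _; rewrite d_sym.
  apply: connect_trans yb; apply: connect1.
  by rewrite /double_cover /= exy.
have [ep /=] := double_cover_path dp; rewrite -px => /esym/= podd.
exists x, (map fst p); split=> //; last by rewrite size_map.
by rewrite (last_map fst p (x, false)) -px.
Qed.

(** Each edge of the walk contributes at least 1 when the memberships of its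
    two ends are added; an inner visit is counted in two edges, the first and
    the last vertex in one. *)
Lemma walk_cover_count (C : {set V}) x p : vertex_cover e C -> path e x p ->
  (size p + (last x p \in C) <= (x \in C) + 2 * \sum_(z <- p) (z \in C))%N.
Proof.
move=> Ccov; elim: p x => [|y p IHp] x /=; first by rewrite big_nil; lia.
move=> /andP[exy /IHp]; rewrite big_cons; have := Ccov _ _ exy.
by case=> ->; lia.
Qed.

Lemma nonbipartite_gap : ~ bipartite e ->
  exists s t, [/\ (0 < t)%N, (t < s)%N & forall r, (0 < r)%N ->
    ~ (symbolic_power J (s * r) `<=` ideal_power J (t * r))].
Proof.
move=> /odd_closed_walk[x [p [ep px p_odd]]].
pose wt (m : 'X_{1..n}) := (\sum_(z <- p) m.@z)%N.
have wtD a b : wt (a + b)%MM = (wt a + wt b)%N.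
  by rewrite /wt -big_split; apply: eq_bigr => z _; rewrite mnmDE.
pose k := (size p)./2.+1.
have pk : size p = (k.*2.-1)%N by rewrite /k; lia.
have wt_cover C : vertex_cover e C -> (k <= wt (cover_mnm C))%N.
  move=> Ccov; have := walk_cover_count Ccov ep; rewrite px addnC leq_add2l pk.
  rewrite /wt; under [X in (_ -> _ <= X)%N]eq_bigr => z _ do rewrite cover_mnmE.
  by rewrite /k; lia.
(* With the (k+1)r-th power of the product of all variables, the weight
   (k+1)(2k-1)r falls short of the (2k+1)kr required by the ordinary power,
   the difference being r. *)
exists (2 * k.+1)%N, k.*2.+1; split=> // [|r r0 sub]; first by lia.
have := vertices_in_symbolic_square (k.+1 * r).
rewrite mulnA => /sub; rewrite mpolyXn.
move/(weight_ideal_power wtD (cover_ideal_wt wtD wt_cover))/weight_idealX.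
rewrite /wt.
under [X in (_ <= X)%N]eq_bigr => z _ do rewrite mulmnE cover_mnmE inE mul1n.
rewrite big_const_seq count_predT iter_addn_0.
nia.
Qed.

End CoverIdeals.

(** * Suprema of ratios *)

Section Ratios.
Variable F : realType.
Implicit Types Q : nat -> nat -> Prop.

(** Resurgence and asymptotic resurgence are both of this form, Q s t being the
    relevant failure of containment. *)
Definition ratio_sup Q : \bar F :=
  ereal_sup [set z | exists s t : nat,
    [/\ (0 < s)%N, (0 < t)%N, Q s t & z = (s%:R / t%:R)%:E]].

Lemma ratio_sup_eq1 Q :
  (forall s t, (0 < s)%N -> (0 < t)%N -> Q s t <-> (s < t)%N) ->
  ratio_sup Q = 1%:E.
Proof.
move=> QE; apply/le_anti/andP; split.
  apply: ge_ereal_sup => _ [s [t [s0 t0 /(QE _ _ s0 t0) st ->]]].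
  by rewrite lee_fin ler_pdivrMr ?ltr0n // mul1r ler_nat ltnW.
(* The fractions (k+1)/(k+2) approach 1. *)
apply/lee_subgt0Pr => eps eps0.
have [k /=] := ltr_add_invr eps0; rewrite add0r => keps.
have {}keps : k.+2%:R^-1 <= eps.
  by apply: le_trans (ltW keps); rewrite lef_pV2 ?posrE ?ltr0n // ler_nat.
have kE : k.+1%:R / k.+2%:R = 1 - k.+2%:R^-1 :> F.
  rewrite -[k.+1%:R](addrK 1) natr1 mulrBl mul1r divff ?pnatr_eq0 //.
apply: (@le_trans _ _ (k.+1%:R / k.+2%:R)%:E).
  by rewrite kE -EFinB lee_fin lerD2l lerN2.
by apply: ereal_sup_ubound; exists k.+1, k.+2; split=> //; apply/QE.
Qed.

Lemma ratio_sup_neq1 Q s t : (0 < t)%N -> (t < s)%N -> Q s t ->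
  ratio_sup Q <> 1%:E.
Proof.
move=> t0 ts Qst sup1.
suff : (ratio_sup Q > 1%:E)%E by rewrite sup1 ltxx.
apply: (@lt_le_trans _ _ (s%:R / t%:R)%:E).
  by rewrite lte_fin ltr_pdivlMr ?ltr0n // mul1r ltr_nat.
by apply: ereal_sup_ubound; exists s, t; split=> //; exact: leq_ltn_trans ts.
Qed.

End Ratios.

(** * Resurgence and bipartiteness *)

Theorem theorem4p8 (F : realType) (K : fieldType) (V : finType) (e : rel V)
    (e_simple : simple_graph e) (V_nonempty : (0 < #|V|)%N)
    (e_no_isolated : no_isolated_vertex e) :
  [<-> resurgence F (cover_ideal K e) = 1%:E;
       bipartite e;
       asymptotic_resurgence F (cover_ideal K e) = 1%:E].
Proof.
have has_edge : exists x y, e x y.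
  case/card_gt0P: V_nonempty => x _.
  by have [y exy] := e_no_isolated x; exists x, y.
have subE : bipartite e -> forall s t,
    ~ (symbolic_power (cover_ideal K e) s `<=` ideal_power (cover_ideal K e) t)
      <-> (s < t)%N.
  move=> bip s t; split=> [|]; last exact: symbolic_not_sub.
  by rewrite ltnNge => nsub; apply/negP => ts; apply: nsub;
    apply: bipartite_symbolic_sub.
have bip_res : bipartite e -> resurgence F (cover_ideal K e) = 1%:E.
  by move=> bip; apply: ratio_sup_eq1 => s t _ _; exact: subE.
have bip_asym : bipartite e -> asymptotic_resurgence F (cover_ideal K e) = 1%:E.
  move=> bip; apply: ratio_sup_eq1 => s t _ _; split=> [[N _ nsub]|st].
    have /(subE bip) := nsub N.+1 (leqnSn N).
    by rewrite ltn_mul2r => /andP[].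
  exists 1%N => // r /= r0; apply/subE => //.
  by rewrite ltn_mul2r st andbT.
have res_bip : resurgence F (cover_ideal K e) = 1%:E -> bipartite e.
  move=> res1; apply: contrapT => /(nonbipartite_gap K e_simple).
  move=> [s [t [t0 ts nsub]]]; apply: ratio_sup_neq1 t0 ts _ res1.
  by have := nsub 1%N isT; rewrite !muln1.
have asym_bip : asymptotic_resurgence F (cover_ideal K e) = 1%:E -> bipartite e.
  move=> res1; apply: contrapT => /(nonbipartite_gap K e_simple).
  move=> [s [t [t0 ts nsub]]]; apply: ratio_sup_neq1 t0 ts _ res1.
  by exists 1%N => // r r0; exact: nsub.
by tfae => // asym1; exact/bip_res/asym_bip.
Qed.
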